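(* Let $N\ge3$, let $x_1,\dots,x_N\in\mathbb{R}^2$ be non-collinear (not all on one line) sensor positions, and let $C\subset\mathbb{R}^2$ be a compact region of area $A$ divided into compact regions $W_1,\dots,W_N$, with $W_j$ of area $A_j$, with union $C$ and pairwise overlaps of zero area. Let the source $s$ lie in $W_i$ and in no $W_j$ with $j\ne i$. Let the measurements be $\ln P_{r_l}=\ln\frac{Pd_0}{d_0+\|x_l-s\|^\beta}+n_l$, $l\in\{1,\dots,N\}$, where $n_1,\dots,n_N$ are i.i.d. Gaussian with mean $0$ and variance $\sigma^2$. Then $$\mathrm{Prob}\Big[p(\ln P_{r_1},\dots,\ln P_{r_N}\mid H_i)P(H_i)\ge\Psi(\sigma)\Big]\ge\Omega(\sigma),$$ where $$\Psi(\sigma)=p(\ln P_{r_1},\dots,\ln P_{r_N})-\sum_{\substack{j=1,\dots,N\\ j\ne i}}\frac{A_j\exp(-L_j/(4\sigma^2))}{A(2\pi\sigma^2)^{N/2}},\qquad \Omega(\sigma)=\prod_{\substack{j=1,\dots,N\\ j\ne i}}\big(1-2Q(\eta_j/\sigma)\big)^N .$$ Furthermore, as $\sigma\to0^+$, $\Psi(\sigma)\to p(\ln P_{r_1},\dots,\ln P_{r_N})>0$ (that is, $p(\ln P_{r_1},\dots,\ln P_{r_N})>0$ and the difference $p(\ln P_{r_1},\dots,\ln P_{r_N})-\Psi(\sigma)$ tends to $0$), and $\Omega(\sigma)\to1^-$.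
   Context: $P>0$, $d_0>0$, $\beta>2$, $\sigma>0$, $A>0$. $Q(x)=\frac{1}{\sqrt{2\pi}}\int_x^{+\infty}\exp(-y^2/2)\,dy$. $H_j$ is the hypothesis that the source lies in $W_j$, and (uniform prior of the source on $C$) $$p(\ln P_{r_1},\dots,\ln P_{r_N}\mid H_j)P(H_j)=\frac{1}{A(2\pi\sigma^2)^{N/2}}\int_{W_j}\exp\Big(-\frac{\sum_{l=1}^N\big(\ln P_{r_l}-\ln\frac{Pd_0}{d_0+\|y-x_l\|^\beta}\big)^2}{2\sigma^2}\Big)dy,$$ $$p(\ln P_{r_1},\dots,\ln P_{r_N})=\sum_{j=1}^N p(\ln P_{r_1},\dots,\ln P_{r_N}\mid H_j)P(H_j).$$ These are evaluated at the random measurements, so $\Psi(\sigma)$ is a random quantity. For each $j\ne i$ the constants (independent of $\sigma$) are any $U_j>0$, $L_j>0$ with $$U_j\ge\max_{y\in W_j,\ l\in\{1,\dots,N\}}\left|\ln\frac{d_0+\|y-x_l\|^\beta}{d_0+\|s-x_l\|^\beta}\right|,\qquad L_j\le\min_{y\in W_j}\sum_{l=1}^N\left(\ln\frac{d_0+\|y-x_l\|^\beta}{d_0+\|s-x_l\|^\beta}\right)^2,$$ and $\eta_j=\sqrt{U_j^2+\frac{L_j}{2N}}-U_j$. *)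

(* Defs.v *)
From HB Require Import structures.
From mathcomp Require Import all_boot all_order all_algebra.
From mathcomp Require Import all_classical all_reals all_analysis.

Set Implicit Arguments.
Unset Strict Implicit.
Unset Printing Implicit Defensive.
Import Order.TTheory GRing.Theory Num.Theory.
Import numFieldNormedType.Exports.

Local Open Scope classical_set_scope.
Local Open Scope ring_scope.

(* Euclidean distance; the library norm on [R * R] is the sup norm (which
   induces the same topology, so [compact] below is the usual notion). *)
Definition edist {R : realType} (y z : R * R) : R :=
  Num.sqrt ((y.1 - z.1) ^+ 2 + (y.2 - z.2) ^+ 2).

Definition area {R : realType} : set (R * R) -> \bar R :=
  (@lebesgue_measure R \x @lebesgue_measure R)%E.

Definition collinear {R : realType} {N : nat} (x : 'I_N -> R * R) : Prop :=
  exists a b c : R, (a != 0 \/ b != 0) /\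
    forall l, a * (x l).1 + b * (x l).2 = c.

Definition Qfun {R : realType} (x : R) : R :=
  (Num.sqrt (2 * pi))^-1 *
  \int[@lebesgue_measure R]_(y in `[x, +oo[) expR (- y ^+ 2 / 2).

Definition mutually_independent {R : realType} {d : measure_display}
    {T : measurableType d} {Pr : probability T R} {N : nat}
    (n : 'I_N -> {RV Pr >-> R}) : Prop :=
  forall (J : {set 'I_N}) (B : 'I_N -> set R),
    (forall l, measurable (B l)) ->
    Pr (\bigcap_(l in [set` J]) (n l @^-1` B l)) =
      (\prod_(l in J) Pr (n l @^-1` B l))%E.

(* The laws are compared on measurable sets only: equality of the two set
   functions on arbitrary sets would constrain their junk values. *)
Definition iid_normal {R : realType} {d : measure_display}
    {T : measurableType d} {Pr : probability T R} {N : nat}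
    (sigma : R) (n : 'I_N -> {RV Pr >-> R}) : Prop :=
  mutually_independent n /\
  forall (l : 'I_N) (B : set R), measurable B ->
    distribution Pr (n l) B = normal_prob 0 sigma B.

(* [ln (P d0 / (d0 + |y - z|^beta))]: log of the noiseless power received at
   [z] from a source at [y]. *)
Definition log_power {R : realType} (P d0 beta : R) (y z : R * R) : R :=
  ln (P * d0 / (d0 + edist y z `^ beta)).

Definition log_ratio {R : realType} (d0 beta : R) (s y z : R * R) : R :=
  ln ((d0 + edist y z `^ beta) / (d0 + edist s z `^ beta)).

(* [p(m_1, ..., m_N | H_j) P(H_j)] with [W = W_j], where [m l] stands for the
   log-measurement at the sensor [x l]. *)
Definition joint_density {R : realType} {N : nat} (P d0 beta A sigma : R)
    (x : 'I_N -> R * R) (m : 'I_N -> R) (W : set (R * R)) : R :=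
  (A * (2 * pi * sigma ^+ 2) `^ (N%:R / 2))^-1 *
  \int[(@lebesgue_measure R \x @lebesgue_measure R)%E]_(y in W)
    expR (- (\sum_(l < N) (m l - log_power P d0 beta y (x l)) ^+ 2)
          / (2 * sigma ^+ 2)).

Definition total_density {R : realType} {N : nat} (P d0 beta A sigma : R)
    (x : 'I_N -> R * R) (W : 'I_N -> set (R * R)) (m : 'I_N -> R) : R :=
  \sum_(j < N) joint_density P d0 beta A sigma x m (W j).

Definition Psi {R : realType} {N : nat} (P d0 beta A sigma : R)
    (x : 'I_N -> R * R) (W : 'I_N -> set (R * R)) (areaW L : 'I_N -> R)
    (i : 'I_N) (m : 'I_N -> R) : R :=
  total_density P d0 beta A sigma x W m -
  \sum_(j < N | j != i)
    areaW j * expR (- L j / (4 * sigma ^+ 2)) /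
    (A * (2 * pi * sigma ^+ 2) `^ (N%:R / 2)).

Definition eta_const {R : realType} {N : nat} (U L : 'I_N -> R) (j : 'I_N) : R :=
  Num.sqrt (U j ^+ 2 + L j / (2 * N%:R)) - U j.

Definition Omega {R : realType} {N : nat} (U L : 'I_N -> R) (i : 'I_N)
    (sigma : R) : R :=
  \prod_(j < N | j != i) (1 - 2 * Qfun (eta_const U L j / sigma)) ^+ N.

Definition measurement {R : realType} {d : measure_display}
    {T : measurableType d} {Pr : probability T R} {N : nat} (P d0 beta : R)
    (x : 'I_N -> R * R) (s : R * R) (n : 'I_N -> {RV Pr >-> R})
    (w : T) (l : 'I_N) : R :=
  log_power P d0 beta s (x l) + n l w.

(* Main.v *)
Require Import Defs.
From HB Require Import structures.
From mathcomp Require Import all_boot all_order all_algebra.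
From mathcomp Require Import all_classical all_reals all_analysis.
From mathcomp Require Import measurable_realfun ring lra.
Import Order.TTheory GRing.Theory Num.Theory.
Import numFieldNormedType.Exports.
Local Open Scope classical_set_scope.
Local Open Scope ring_scope.

(** The residual at sensor [l] of a candidate position [y] is [r_l + n_l], where
[r_l = log_ratio d0 beta s y (x l)] and [n_l] is the noise.  If [|r_l| <= U_j],
[|n_l| <= eta_j] and [\sum_l r_l ^+ 2 >= L_j], then
[(r_l + n_l) ^+ 2 >= r_l ^+ 2 - 2 * U_j * eta_j], and [eta_j] is the positive
root of [eta ^+ 2 + 2 * U_j * eta = L_j / (2 * N)]; hence the sum of squared
residuals is still at least [L_j / 2] ([eta_constE], [sum_sqr_perturbed]).  The
likelihood is then at most [expR (- L_j / (4 * sigma ^+ 2))] on the whole of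
[W j], so integrating over [W j] bounds the joint density of [H_j] by the [j]-th
term subtracted in [Psi] ([joint_density_le]).  Thus the event of the theorem
contains the event that every [|n_l|] is below the smallest of the [eta_j].

By independence that small-noise event has probability exactly
[(1 - 2 * Qfun (eta / sigma)) ^+ N] for this smallest [eta]
([small_noise_prob]), which is one of the factors of [Omega]; the other factors
lie between [0] and [1], whence the lower bound ([Omega_le_factor]).  The remaining
issue is that the event of the theorem has to be measurable for its
probability to be comparable: the joint density is a measurable function of the
measurements by Tonelli ([measurable_joint_density]).

Positivity of the total density holds because some [W j] has positive area and
the Gaussian integrand is positive.  For the limits,
[p - Psi] is a deterministic sum of terms [expR (- c * u)] times a power of
[u], where [u = (2 * pi * sigma ^+ 2)^-1] tends to infinity ([cvg_gap_term]),
and [Qfun] is positive and vanishes at infinity, so [Omega] tends to [1] while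
staying below it ([cvg_Omega]). *)

(** * Borel measurability in the plane *)

(** An open set is the union of the squares with rational centre and radius
[1 / (k + 1)] that it contains; there are countably many of them. *)
Lemma open_measurable_prod (R : realType) (V : set (R * R)) :
  open V -> measurable V.
Proof.
move=> oV.
pose box (q : rat * rat * nat) : set (R * R) :=
  `]ratr q.1.1 - q.2.+1%:R^-1, ratr q.1.1 + q.2.+1%:R^-1[ `*`
  `]ratr q.1.2 - q.2.+1%:R^-1, ratr q.1.2 + q.2.+1%:R^-1[.
have -> : V = \bigcup_(q in [set q | box q `<=` V]) box q.
  apply/seteqP; split => [y Vy|y [q /= qV qy]]; last exact: qV.
  have [e e0 eV] : exists2 e : R, 0 < e & ball y e `<=` V.
    have /nbhs_ballP[e /= e0 eV] : nbhs y V by exact: open_nbhs_nbhs.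
    by exists e.
  (* A square of radius [r] around a point within [r] of [y] stays within
     [2 * r] of [y]. *)
  have [k ke] : exists k : nat, k.+1%:R^-1 + k.+1%:R^-1 < e.
    have e20 : 0 < e / 2 by rewrite divr_gt0.
    have [k _ kP] := near_infty_natSinv_lt (PosNum e20).
    exists k; have := kP k (leqnn k) => /= ke.
    by rewrite [ltRHS](splitr e) ltrD.
  have k0 : 0 < k.+1%:R^-1 :> R by rewrite invr_gt0.
  set r := k.+1%:R^-1 in ke k0 *.
  have rat_near (z : R) : exists q : rat, z - r < ratr q < z + r.
    have /rat_in_itvoo[q] : z - r < z + r by lra.
    by rewrite in_itv /= => qz; exists q.
  have [q1 q1P] := rat_near y.1; have [q2 q2P] := rat_near y.2.
  exists ((q1, q2), k).
    move=> z [/=]; rewrite -/r !in_itv /= => z1 z2; apply: eV.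
    by split; rewrite /ball /= ltr_norml; lra.
  by split; rewrite /= -/r in_itv /=; lra.
rewrite bigcup_mkcond; apply: countable_bigcupT_measurable => // q.
case: ifPn => // _; apply: measurableX; exact: measurable_itv.
Qed.

Lemma compact_measurable_prod (R : realType) (V : set (R * R)) :
  compact V -> measurable V.
Proof.
move=> cV; have /closed_openC/open_measurable_prod : closed V.
  by apply: compact_closed => //; exact: norm_hausdorff.
by move/measurableC; rewrite setCK.
Qed.

Lemma measurable_edist (R : realType) (z : R * R) :
  measurable_fun [set: R * R] (fun y => Defs.edist y z).
Proof.
apply: (measurableT_comp
  (continuous_measurable_fun (@sqrt_continuous R))) => //.
by apply: measurable_funD; apply: measurable_funX; apply: measurable_funB;
  [exact: measurable_fst|exact: measurable_cst
  |exact: measurable_snd|exact: measurable_cst].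
Qed.

(** The two coordinates of the plane are integrated out one after the other, so
that Tonelli's theorem is only applied with Lebesgue measure on the line as the
measure integrated out, which is sigma-finite. *)
Lemma measurable_integral_prod (R : realType) (d : measure_display)
    (T : measurableType d) (f : T * (R * R) -> \bar R) :
  measurable_fun setT f -> (forall z, (0 <= f z)%E) ->
  measurable_fun setT
    (fun w => \int[(@lebesgue_measure R \x @lebesgue_measure R)]_y f (w, y))%E.
Proof.
move=> mf f0.
pose g (w : (T * R) * R) := f (w.1.1, (w.1.2, w.2)).
have mg : measurable_fun setT g.
  apply: measurableT_comp => //.
  apply/measurable_fun_pairP; split => /=.
    exact: measurableT_comp measurable_fst measurable_fst.
  apply/measurable_fun_pairP; split => /=; last exact: measurable_snd.
  exact: measurableT_comp measurable_snd measurable_fst.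
have g0 z : (0 <= g z)%E by exact: f0.
have mG := @measurable_fun_fubini_tonelli_F _ _ _ _ R
  (@lebesgue_measure R) _ mg g0.
have G0 z : (0 <= fubini_F (@lebesgue_measure R) g z)%E.
  by apply: integral_ge0 => y _.
have := @measurable_fun_fubini_tonelli_F _ _ _ _ R
  (@lebesgue_measure R) _ mG G0.
apply: eq_measurable_fun => w _.
rewrite fubini_tonelli1//.
by apply: measurableT_comp => //; exact: measurable_pair1.
Qed.

(** * The log-power of a noiseless measurement *)

Lemma log_powerE (R : realType) (P d0 beta : R) (y z : R * R) :
  0 < P -> 0 < d0 ->
  log_power P d0 beta y z = ln (P * d0) - ln (d0 + Defs.edist y z `^ beta).
Proof.
move=> P0 d00; rewrite /log_power ln_div// posrE ?mulr_gt0//.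
by rewrite ltr_pwDl// powR_ge0.
Qed.

Lemma log_powerB (R : realType) (P d0 beta : R) (s y z : R * R) :
  0 < P -> 0 < d0 ->
  log_power P d0 beta s z - log_power P d0 beta y z = log_ratio d0 beta s y z.
Proof.
move=> P0 d00; have pos u : 0 < d0 + Defs.edist u z `^ beta.
  by rewrite ltr_pwDl// powR_ge0.
by rewrite !log_powerE// /log_ratio ln_div ?posrE//; ring.
Qed.

Lemma measurable_log_power (R : realType) (P d0 beta : R) (z : R * R) :
  0 < P -> 0 < d0 ->
  measurable_fun [set: R * R] (fun y => log_power P d0 beta y z).
Proof.
move=> P0 d00; under eq_fun do rewrite log_powerE//.
apply: measurable_funB => //.
apply: (measurableT_comp (@measurable_ln R)) => //.
apply: measurable_funD => //.
apply: (measurableT_comp (@measurable_powR R beta)) => //.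
exact: measurable_edist.
Qed.

(** * Integrals of positive functions and null unions *)

(** A nonnegative function of zero integral vanishes almost everywhere on [D],
so a positive one would make [D] a null set. *)
Lemma integral_gt0 (d : measure_display) (T : measurableType d) (R : realType)
    (mu : {measure set T -> \bar R}) (D : set T) (f : T -> \bar R) :
  measurable D -> mu D != 0%E -> measurable_fun D f ->
  (forall t, D t -> (0 < f t)%E) -> (0 < \int[mu]_(t in D) f t)%E.
Proof.
move=> mD muD mf f0.
rewrite lt0e integral_ge0 ?andbT => [|t Dt]; last exact/ltW/f0.
apply: contra muD => /eqP intf0; apply/eqP.
have /(ae_eq_integral_abs mu mD mf) : (\int[mu]_(t in D) `|f t| = 0)%E.
  rewrite -[RHS]intf0; apply: eq_integral => t.
  by rewrite inE => /f0/ltW/gee0_abs.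
move=> f_ae0; apply: measure_negligible => //.
apply: negligibleS f_ae0 => t Dt /= /(_ Dt) ft0.
by have := f0 _ Dt; rewrite ft0 ltxx.
Qed.

Lemma measure_bigcup_eq0 (d : measure_display) (T : measurableType d)
    (R : realType) (mu : {measure set T -> \bar R}) (I : finType)
    (F : I -> set T) :
  (forall k, measurable (F k)) -> (forall k, mu (F k) = 0%E) ->
  mu (\bigcup_k F k) = 0%E.
Proof.
move=> mF F0.
have -> : \bigcup_k F k = \big[setU/set0]_k F k.
  apply/seteqP; split=> [t [k _ Fkt]|t].
    by rewrite (bigD1 k)//=; left.
  by elim/big_ind : _ => // [A B AU BU []//|k _ Fkt]; exists k.
apply: measure_negligible; first exact: bigsetU_measurable.
elim/big_ind : _ => [|A B|k _]; [exact: negligible_set0|exact: negligibleU|].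
by apply/negligibleP; [exact: mF|exact: F0].
Qed.

(** * The Gaussian tail function *)

(** Substitution [t |-> sigma * t]. *)
Lemma Qfun_normal_prob (R : realType) (sigma a : R) : 0 < sigma ->
  normal_prob 0 sigma `[a, +oo[ = (Qfun (a / sigma))%:E.
Proof.
move=> s0; have sn0 : sigma != 0 by rewrite gt_eqF.
pose F (t : R) := sigma * t.
have F'E : F^`()%classic = cst sigma.
  apply/funext => t; rewrite /F derive1E deriveM// derive_cst scaler0 addr0.
  by rewrite derive_id /GRing.scale/= mulr1.
have intg : (@lebesgue_measure R).-integrable `[a / sigma, +oo[
    (fun t => (expR (- t ^+ 2 / 2))%:E).
  have int1 : (@lebesgue_measure R).-integrable `[a / sigma, +oo[
      (fun t => (normal_pdf 0 1 t)%:E).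
    exact: integrableS (integrable_normal_pdf 0 1).
  refine (@eq_integrable _ _ R _ _ _ _ _ _
    (integrableZl _ (normal_peak 1)^-1 int1)) => //.
  move=> t _ /=; rewrite -EFinM normal_pdfE ?oner_neq0//.
  rewrite mulKf ?gt_eqF ?normal_peak_gt0 ?oner_neq0//.
  by rewrite /normal_fun subr0 expr1n.
set u := a / sigma in intg *.
have -> : a = F u by rewrite /F /u mulrC divfK.
rewrite /normal_prob increasing_ge0_integration_by_substitutiony; last 8 first.
- by move=> t v _ _; rewrite /F ltr_pM2l.
- by rewrite F'E => t _; exact: cvg_cst.
- by rewrite F'E; exact: is_cvg_cst.
- by rewrite F'E; exact: is_cvg_cst.
- split; first by move=> t _; exact: derivableM.
  apply: cvg_at_right_filter; apply: cvgM; [exact: cvg_cst|exact: cvg_id].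
- exact: gt0_cvgMry.
- by apply: continuous_subspaceT; exact: continuous_normal_pdf.
- by move=> t _; exact: normal_pdf_ge0.
rewrite /Qfun EFinM /Rintegral fineK; last first.
  by apply: (integrable_fin_num _ intg).
rewrite -integralZl//.
apply: eq_integral => t _; rewrite F'E -EFinM; congr EFin.
rewrite /= normal_pdfE// !fctE /= /normal_peak /normal_fun /F subr0.
have -> : sigma ^+ 2 * pi *+ 2 = sigma ^+ 2 * (2 * pi) by ring.
rewrite sqrtrM ?sqr_ge0// sqrtr_sqr gtr0_norm// invfM mulrC mulrA mulVKf//.
by congr (_ * expR _); field.
Qed.

Lemma normal_prob_symm (R : realType) (sigma a : R) : 0 < sigma ->
  normal_prob 0 sigma `]-oo, - a] = normal_prob 0 sigma `[a, +oo[.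
Proof.
move=> s0; rewrite /normal_prob ge0_integration_by_substitutionNy.
- apply: eq_integral => t _ /=; congr EFin.
  by rewrite normal_pdfE ?gt_eqF// /normal_fun !subr0 sqrrN.
- by apply: continuous_subspaceT; apply: continuous_normal_pdf; rewrite gt_eqF.
- by move=> t _; exact: normal_pdf_ge0.
Qed.

(** The complement consists of the two tails, which have equal mass. *)
Lemma normal_prob_centered_itv (R : realType) (sigma a : R) :
  0 < sigma -> 0 < a ->
  normal_prob 0 sigma `]- a, a[ = (1 - 2 * Qfun (a / sigma))%:E.
Proof.
move=> s0 a0.
have -> : `]- a, a[%classic = ~` (`]-oo, - a] `|` `[a, +oo[).
  apply/seteqP; split => t /=; rewrite !in_itv /= ?andbT.
    by move=> /andP[ta at_] []; lra.
  by move=> /not_orP[/negP + /negP]; rewrite -!ltNge => -> ->.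
rewrite probability_setC; last by apply: measurableU; exact: measurable_itv.
rewrite measureU//=; last first.
  apply/seteqP; split => t //= []; rewrite !in_itv/= andbT; lra.
rewrite normal_prob_symm// Qfun_normal_prob// -EFinD.
by congr EFin; rewrite /=; ring.
Qed.

Lemma Qfun_gt0 (R : realType) (t : R) : 0 < Qfun t.
Proof.
rewrite -lte_fin -[t]divr1 -Qfun_normal_prob//.
apply: integral_gt0; first exact: measurable_itv.
- apply/eqP => mu0.
  have : lebesgue_measure (`[t, +oo[%classic : set R) = +oo%E.
    by rewrite lebesgue_measure_itv/= ltry.
  by move: mu0 => /= ->.
- apply/measurable_EFinP; apply: measurable_funTS.
  exact: measurable_normal_pdf.
- move=> y _; rewrite normal_pdfE ?oner_neq0// lte_fin.
  by rewrite mulr_gt0 ?normal_peak_gt0 ?oner_neq0// expR_gt0.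
Qed.

(** The difference [1 - 2 * Qfun t] is the standard normal mass of the open
interval from [- t] to [t]. *)
Lemma Qfun_le_half (R : realType) (t : R) : 0 < t -> 2 * Qfun t <= 1.
Proof.
by move=> t0; rewrite -subr_ge0 -lee_fin -[t]divr1 -normal_prob_centered_itv//.
Qed.

(** [Qfun t] is the mass of a closed half-line, which lies inside the open
half-line starting at [t - 1]; the mass of the latter is a complementary
cumulative distribution function, that of the identity. *)
Lemma cvg_Qfun (R : realType) : @Qfun R t @[t --> +oo] --> 0.
Proof.
have mid : measurable_fun setT (idfun : measurableTypeR R -> R).
  exact: measurable_id.
pose X : {RV (normal_prob (0 : R) 1) >-> R} :=
  mfun_Sub (aT := measurableTypeR R) (rT := R) (mem_set mid).
have tail0 : fine (normal_prob 0 1 `]u, +oo[) @[u --> +oo] --> (0 : R).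
  exact: (fine_cvg (cvg_ccdfy0 X)).
apply: (@squeeze_cvgr _ _ _ _ (cst 0)
  (fun t => fine (normal_prob 0 1 `]t - 1, +oo[))).
- near=> t; apply/andP; split; first exact/ltW/Qfun_gt0.
  rewrite -lee_fin -[t]divr1 -Qfun_normal_prob// divr1 fineK ?fin_num_measure//.
  apply: le_measure; rewrite ?inE//.
  by move=> y /=; rewrite !in_itv/= !andbT; lra.
- exact: cvg_cst.
- exact: cvg_comp (cvg_addrr (-1)) tail0.
Unshelve. all: by end_near. Qed.

(** * The likelihood and its integral over a region *)

Section density.
Context {R : realType} {N : nat} (P d0 beta A sigma : R) (x : 'I_N -> R * R).
Hypotheses (P0 : 0 < P) (d00 : 0 < d0).

Local Notation mu := (@lebesgue_measure R \x @lebesgue_measure R)%E.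

Definition sqresidual (m : 'I_N -> R) (y : R * R) : R :=
  \sum_(l < N) (m l - log_power P d0 beta y (x l)) ^+ 2.

Definition likelihood (m : 'I_N -> R) (y : R * R) : R :=
  expR (- sqresidual m y / (2 * sigma ^+ 2)).

Lemma measurable_likelihood (d : measure_display) (T : measurableType d)
    (m : T -> 'I_N -> R) (y : T -> R * R) :
  (forall l, measurable_fun setT (fun w => m w l)) -> measurable_fun setT y ->
  measurable_fun setT (fun w => likelihood (m w) (y w)).
Proof.
move=> mm my; apply: (measurableT_comp (@measurable_expR R)) => //.
apply: measurable_funM => //; apply: measurableT_comp => //.
apply: measurable_sum => l; apply: measurable_funX; apply: measurable_funB => //.
exact: measurableT_comp (measurable_log_power _ _ _ beta (x l) P0 d00) my.
Qed.

Lemma likelihood_le1 m y : likelihood m y <= 1.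
Proof.
rewrite -expR0 ler_expR mulNr oppr_le0; apply: divr_ge0.
  by apply: sumr_ge0 => l _; exact: sqr_ge0.
by rewrite mulr_ge0 ?sqr_ge0.
Qed.

Lemma integrable_likelihood (m : 'I_N -> R) (V : set (R * R)) (a : R) :
  measurable V -> mu V = a%:E ->
  mu.-integrable V (fun y => (likelihood m y)%:E).
Proof.
move=> mV Va; apply: measurable_bounded_integrable => //.
- by move: (ltry a); rewrite -Va.
- apply: measurable_funTS.
  have H := @measurable_likelihood _ (measurableTypeR R * measurableTypeR R)%type
    (fun _ => m) idfun.
  by apply: H => //; exact: measurable_id.
- exists 1; split => // M M1 y _ /=.
  by rewrite ger0_norm ?expR_ge0// (le_trans (likelihood_le1 m y))// ltW.
Qed.

Lemma density_const_gt0 : 0 < A -> 0 < sigma ->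
  0 < A * (2 * pi * sigma ^+ 2) `^ (N%:R / 2).
Proof.
move=> A0 s0; rewrite mulr_gt0// powR_gt0// mulr_gt0 ?exprn_gt0//.
by rewrite mulr_gt0 ?pi_gt0.
Qed.

Lemma joint_density_ge0 m V : 0 < A -> 0 < sigma ->
  0 <= joint_density P d0 beta A sigma x m V.
Proof.
move=> A0 s0; rewrite mulr_ge0 ?invr_ge0 ?(ltW (density_const_gt0 _ _))//.
by apply: Rintegral_ge0 => y _; exact: expR_ge0.
Qed.

Lemma joint_density_gt0 m V (a : R) : 0 < A -> 0 < sigma ->
  measurable V -> mu V = a%:E -> a != 0 ->
  0 < joint_density P d0 beta A sigma x m V.
Proof.
move=> A0 s0 mV Va a0; rewrite mulr_gt0 ?invr_gt0 ?density_const_gt0//.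
have intf := integrable_likelihood m V a mV Va.
rewrite fine_gt0//; apply/andP; split; last first.
  by rewrite ltey_eq (integrable_fin_num mV intf).
apply: integral_gt0 => //; first by move: a0; rewrite -eqe -Va.
  exact: measurable_int intf.
by move=> y _; rewrite lte_fin expR_gt0.
Qed.

(** The integrand is at most its value where the sum of squared residuals
equals [c / 2], and it is integrated over a region of area [a]. *)
Lemma joint_density_le m V (a c : R) : 0 < A -> 0 < sigma ->
  measurable V -> mu V = a%:E ->
  (forall y, V y -> c / 2 <= sqresidual m y) ->
  joint_density P d0 beta A sigma x m V <=
  a * expR (- c / (4 * sigma ^+ 2)) / (A * (2 * pi * sigma ^+ 2) `^ (N%:R / 2)).
Proof.
move=> A0 s0 mV Va cV; rewrite /joint_density mulrC.
rewrite ler_wpM2r ?invr_ge0 ?(ltW (density_const_gt0 _ _))//.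
set e := expR (- c / (4 * sigma ^+ 2)).
have -> : a * e = (\int[mu]_(y in V) e)%R.
  rewrite Rintegral_cst// mulrC; congr (e * _).
  by have /(congr1 fine) /= := Va.
apply: le_Rintegral => //.
- exact: (integrable_likelihood m V a mV Va).
- apply: measurable_bounded_integrable => //.
    by move: (ltry a); rewrite -Va.
  by exists `|e|; split => // M eM y _ /=; exact: ltW.
- move=> y /cV cy; rewrite ler_expR.
  have s20 : 0 < sigma ^+ 2 by rewrite exprn_gt0.
  rewrite !mulNr lerN2 ler_pdivlMr ?mulr_gt0//.
  apply: le_trans cy; rewrite le_eqVlt; apply/orP; left; apply/eqP; field.
  by rewrite gt_eqF.
Qed.

(** The integral over [V] is that of the likelihood times the indicator of [V],
a nonnegative function jointly measurable in the outcome and the position. *)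
Lemma measurable_joint_density (d : measure_display) (T : measurableType d)
    (m : T -> 'I_N -> R) V :
  (forall l, measurable_fun setT (fun w => m w l)) -> measurable V ->
  measurable_fun setT (fun w => joint_density P d0 beta A sigma x (m w) V).
Proof.
move=> mm mV; apply: measurable_funM => //.
apply: (measurableT_comp (@fine_measurable R _ measurableT)) => //.
under eq_fun do rewrite integral_mkcond.
pose f (wy : T * (R * R)) : \bar R :=
  ((fun y => (likelihood (m wy.1) y)%:E) \_ V)%E wy.2.
apply: (@measurable_integral_prod R _ T f) => [|[w y]]; last first.
  by rewrite /f patchE; case: ifP => // _; rewrite lee_fin expR_ge0.
have -> : f = (fun wy => (likelihood (m wy.1) wy.2 * \1_V wy.2)%:E).
  apply/funext => -[w y]; rewrite /f patchE indicE /=.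
  by case: ifP => _; rewrite ?mulr1 ?mulr0.
apply/measurable_EFinP; apply: measurable_funM.
  apply: measurable_likelihood => [l|]; last exact: measurable_snd.
  exact: measurableT_comp (mm l) measurable_fst.
exact: measurableT_comp (measurable_indic mV) measurable_snd.
Qed.

End density.

(** * Limits as the noise vanishes *)

(** The exponential dominates the term of degree [N + 1] of its series, one
more than the exponent [N] that bounds [N / 2]; the extra power leaves a
factor [1 / u]. *)
Lemma powR_expR_le (R : realType) (N : nat) (c u : R) : 0 < c -> 1 <= u ->
  u `^ (N%:R / 2) * expR (- (c * u)) <= (N.+1`!%:R / c ^+ N.+1) / u.
Proof.
move=> c0 u1; have u0 : 0 < u by rewrite (lt_le_trans _ u1).
have uN : u `^ (N%:R / 2) <= u ^+ N.
  rewrite -powR_mulrn ?(ltW u0)// ler_powR//.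
  have : 0 <= N%:R :> R by []. lra.
have cu0 : 0 < c * u by rewrite mulr_gt0.
have cuN := expR_ge1Dxn N (ltW cu0).
have f0 : 0 < N.+1`!%:R :> R by rewrite ltr0n fact_gt0.
rewrite expRN ler_pdivrMr ?expR_gt0//.
apply: (le_trans uN).
apply: (@le_trans _ _ (N.+1`!%:R / c ^+ N.+1 / u *
    ((c * u) ^+ N.+1 / N.+1`!%:R))).
  rewrite le_eqVlt; apply/orP; left; apply/eqP.
  rewrite exprMn !exprS; field.
  by rewrite !gt_eqF ?exprn_gt0// ?mulr_gt0.
by rewrite ler_pM2l ?divr_gt0 ?exprn_gt0//; apply: le_trans cuN; rewrite lerDr.
Qed.

(** In terms of [u = (2 * pi * sigma ^+ 2)^-1] the expression is a constant
times [u `^ (N / 2) * expR (- (c * u))] with [c = L * pi / 2]. *)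
Lemma cvg_gap_term (R : realType) (N : nat) (A a L : R) : 0 < L ->
  a * expR (- L / (4 * sigma ^+ 2)) / (A * (2 * pi * sigma ^+ 2) `^ (N%:R / 2))
    @[sigma --> 0^'+] --> 0.
Proof.
move=> L0; have pi0 : 0 < pi :> R := pi_gt0 R.
pose c := L * pi / 2; have c0 : 0 < c by rewrite divr_gt0 ?mulr_gt0.
pose K := N.+1`!%:R / c ^+ N.+1.
rewrite -[X in _ --> X](mulr0 (a / A)).
have E (sigma : R) : 0 < sigma ->
    a * expR (- L / (4 * sigma ^+ 2)) /
      (A * (2 * pi * sigma ^+ 2) `^ (N%:R / 2)) =
    (a / A) * ((2 * pi * sigma ^+ 2)^-1 `^ (N%:R / 2) *
      expR (- (c * (2 * pi * sigma ^+ 2)^-1))).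
  move=> s0; have u0 : 0 < 2 * pi * sigma ^+ 2 by rewrite !mulr_gt0 ?exprn_gt0.
  have -> : - L / (4 * sigma ^+ 2) = - (c * (2 * pi * sigma ^+ 2)^-1).
    (* [pi] is generalized because [field] would unfold it. *)
    by rewrite /c; move: (pi) pi0 => p p0; field; rewrite !gt_eqF.
  set u := 2 * pi * sigma ^+ 2 in u0 *.
  have -> : u^-1 `^ (N%:R / 2) = (u `^ (N%:R / 2))^-1.
    by rewrite -powRN -[u^-1]powR_inv1 ?(ltW u0)// -powRrM mulN1r.
  by rewrite (invfM A) -!mulrA; congr (a * _); rewrite mulrC -mulrA.
apply: (@cvg_trans _ ((a / A) * ((2 * pi * sigma ^+ 2)^-1 `^ (N%:R / 2) *
    expR (- (c * (2 * pi * sigma ^+ 2)^-1))) @[sigma --> 0^'+])).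
  apply: near_eq_cvg; near=> sigma; apply/esym/E.
  by near: sigma; exact: nbhs_right_gt.
apply: cvgM; first exact: cvg_cst.
have s2 : 2 * pi * sigma ^+ 2 @[sigma --> (0:R)^'+] --> (0:R).
  apply: cvg_at_right_filter; rewrite -[X in _ --> X](mulr0 (2 * pi)).
  apply: cvgM; first exact: cvg_cst.
  rewrite -[X in _ --> X](mulr0 0); under eq_fun do rewrite expr2.
  by apply: cvgM; exact: cvg_id.
apply: (@squeeze_cvgr _ _ _ _ (cst 0) (fun sigma => K * (2 * pi * sigma ^+ 2))).
- near=> sigma; apply/andP; split; first by rewrite mulr_ge0 ?powR_ge0 ?expR_ge0.
  have s0 : 0 < sigma by near: sigma; exact: nbhs_right_gt.
  have u0 : 0 < 2 * pi * sigma ^+ 2 by rewrite !mulr_gt0 ?exprn_gt0.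
  rewrite -[X in K * X]invrK; apply: powR_expR_le => //.
  rewrite invf_ge1//; near: sigma.
  by apply: cvgr_le s2 _ _.
- exact: cvg_cst.
- by rewrite -[X in _ --> X](mulr0 K); apply: cvgM => //; exact: cvg_cst.
Unshelve. all: by end_near. Qed.

Lemma cvg_inv_at_right0 (R : realType) : x^-1 @[x --> (0 : R)^'+] --> +oo.
Proof.
apply/gtr0_cvgV0.
  by near=> x; rewrite invr_gt0; near: x; exact: nbhs_right_gt.
apply: cvg_at_right_filter; under eq_fun do rewrite /= invrK.
exact: cvg_id.
Unshelve. all: by end_near. Qed.

(** * The noise thresholds [eta_const] and the product [Omega] *)

Section eta.
Context {R : realType} {N : nat} (U L : 'I_N -> R) (i : 'I_N).

Lemma eta_const_gt0 j : 0 < U j -> 0 < L j -> (0 < N)%N -> 0 < eta_const U L j.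
Proof.
move=> U0 L0 N0; rewrite subr_gt0 -[ltLHS]gtr0_norm// -sqrtr_sqr ltr_sqrt.
  by rewrite ltrDl divr_gt0// mulr_gt0// ltr0n.
by rewrite addr_gt0 ?exprn_gt0// divr_gt0// mulr_gt0// ltr0n.
Qed.

(** Completing the square: [(eta + U) ^+ 2 = U ^+ 2 + L / (2 * N)]. *)
Lemma eta_constE j : 0 < L j ->
  eta_const U L j ^+ 2 + 2 * U j * eta_const U L j = L j / (2 * N%:R).
Proof.
move=> L0; rewrite /eta_const; set q := Num.sqrt _.
have -> : (q - U j) ^+ 2 + 2 * U j * (q - U j) = q ^+ 2 - U j ^+ 2 by ring.
rewrite sqr_sqrtr ?addr_ge0 ?sqr_ge0 ?divr_ge0 ?mulr_ge0 ?ler0n ?ltW//; ring.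
Qed.

(** Each square drops by at most [2 * a * e <= c / (2 * N)], hence the sum by at
most [c / 2]. *)
Lemma sum_sqr_perturbed (a c e : R) (r n : 'I_N -> R) : (0 < N)%N ->
  (forall l, `|r l| <= a) -> (forall l, `|n l| <= e) ->
  2 * a * e <= c / (2 * N%:R) -> c <= \sum_l r l ^+ 2 ->
  c / 2 <= \sum_l (r l + n l) ^+ 2.
Proof.
move=> N0 ra ne aec cr.
apply: (@le_trans _ _ (\sum_l (r l ^+ 2 - c / (2 * N%:R)))).
  rewrite sumrB sumr_const card_ord -[_ *+ N]mulr_natr.
  have -> : c / (2 * N%:R) * N%:R = c / 2.
    by field; rewrite pnatr_eq0 -lt0n.
  lra.
apply: ler_sum => l _.
have : - (r l * n l) <= a * e.
  apply: (le_trans (ler_norm _)); rewrite normrN normrM.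
  by apply: ler_pM.
have := sqr_ge0 (n l).
have -> : (r l + n l) ^+ 2 = r l ^+ 2 + 2 * (r l * n l) + n l ^+ 2 by ring.
move: aec; lra.
Qed.

Hypotheses (U0 : forall j, j != i -> 0 < U j)
  (L0 : forall j, j != i -> 0 < L j).
Hypothesis N3 : (3 <= N)%N.

Lemma Omega_factor_itv (sigma : R) (j : 'I_N) : 0 < sigma -> j != i ->
  0 <= 1 - 2 * Qfun (eta_const U L j / sigma) < 1.
Proof.
move=> s0 ji; have eta0 := eta_const_gt0 j (U0 j ji) (L0 j ji) (ltnW (ltnW N3)).
have t0 : 0 < eta_const U L j / sigma by rewrite divr_gt0.
have := Qfun_le_half R _ t0; have := Qfun_gt0 R (eta_const U L j / sigma).
by move: (Qfun _) => q; lra.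
Qed.

Lemma prodr_le1_factor (j : 'I_N) (F : 'I_N -> R) :
  (forall k, k != i -> 0 <= F k <= 1) -> j != i ->
  \prod_(k < N | k != i) F k <= F j.
Proof.
move=> F01 ji; rewrite (bigD1 j)//= ler_piMr//; first by case/andP: (F01 _ ji).
by apply: prodr_ile1 => k /andP[ki _]; exact: F01.
Qed.

Lemma Omega_le_factor (sigma : R) (j : 'I_N) : 0 < sigma -> j != i ->
  Omega U L i sigma <= (1 - 2 * Qfun (eta_const U L j / sigma)) ^+ N.
Proof.
move=> s0 ji.
apply: (prodr_le1_factor j
  (fun j => (1 - 2 * Qfun (eta_const U L j / sigma)) ^+ N)) => // k ki.
have /andP[k0 k1] := Omega_factor_itv _ _ s0 ki.
by rewrite exprn_ge0// exprn_ile1// ltW.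
Qed.

Lemma ord_neq_exists : exists j : 'I_N, j != i.
Proof.
have /card_gt0P[j] : (0 < #|predC1 i|)%N.
  by rewrite cardC1 card_ord -ltnS prednK ?(leq_trans _ N3).
by rewrite !inE => ji; exists j.
Qed.

(** Convergence from the left needs [Omega < 1] near [0]: some factor is below
[1] because a second index exists. *)
Lemma cvg_Omega : Omega U L i sigma @[sigma --> 0^'+] --> 1^'-.
Proof.
have cvg1 : Omega U L i sigma @[sigma --> 0^'+] --> (1 : R).
  rewrite -[X in _ --> X](_ : \prod_(j < N | j != i) (1 - 2 * 0) ^+ N = 1);
    last first.
    by rewrite big1// => j _; rewrite mulr0 subr0 expr1n.
  apply: cvg_big => [|j ji]; first exact: mul_continuous.
  have eta0 := eta_const_gt0 j (U0 j ji) (L0 j ji) (ltnW (ltnW N3)).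
  have tail : Qfun (eta_const U L j / sigma) @[sigma --> (0 : R)^'+] --> (0 : R).
    apply: cvg_comp (cvg_Qfun R).
    apply: gt0_cvgMry => //; exact: cvg_inv_at_right0.
  apply: (@cvg_comp _ _ _
    (fun sigma : R => 1 - 2 * Qfun (eta_const U L j / sigma))
    (fun t : R => t ^+ N) _ (nbhs (1 - 2 * 0 : R)));
    last exact: exprn_continuous.
  apply: cvgB; first exact: cvg_cst.
  by apply: cvgM => //; exact: cvg_cst.
have lt1 : \forall sigma \near (0 : R)^'+, Omega U L i sigma < 1.
  have [j ji] := ord_neq_exists.
  near=> sigma.
  have s0 : 0 < sigma by near: sigma; exact: nbhs_right_gt.
  apply: (le_lt_trans (Omega_le_factor _ j s0 ji)).
  have /andP[k0 k1] := Omega_factor_itv _ _ s0 ji.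
  by rewrite exprn_ilt1// -lt0n (leq_trans _ N3).
move=> V V1; apply: filterS2 lt1 (cvg1 _ V1) => sigma o1; exact.
Unshelve. all: by end_near. Qed.

End eta.

(** * The small-noise event *)

Section small_noise.
Context {R : realType} {N : nat} {d : measure_display} {T : measurableType d}
  {Pr : probability T R}.

Lemma small_noiseE (e : R) (n : 'I_N -> {RV Pr >-> R}) :
  [set w | forall l, - e < n l w < e] =
  \bigcap_(l in [set` [set: 'I_N]%SET]) (n l @^-1` `]- e, e[).
Proof.
apply/seteqP; split => w /= nw l.
  by move=> _ /=; rewrite in_itv/=; exact: nw.
by have := nw l (finset.in_setT l); rewrite /= in_itv.
Qed.

Lemma measurable_small_noise (e : R) (n : 'I_N -> {RV Pr >-> R}) :
  measurable [set w | forall l, - e < n l w < e].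
Proof.
rewrite small_noiseE; apply: fin_bigcap_measurable => // l _.
exact: measurable_funPTI.
Qed.

Lemma small_noise_prob (sigma e : R) (n : 'I_N -> {RV Pr >-> R}) :
  0 < sigma -> 0 < e -> iid_normal sigma n ->
  Pr [set w | forall l, - e < n l w < e] =
  ((1 - 2 * Qfun (e / sigma)) ^+ N)%:E.
Proof.
move=> s0 e0 [indep law]; rewrite small_noiseE.
rewrite (indep [set: 'I_N]%SET (fun=> `]- e, e[%classic)); last first.
  by move=> l; exact: measurable_itv.
have factor l : Pr (n l @^-1` `]- e, e[) = (1 - 2 * Qfun (e / sigma))%:E.
  rewrite -normal_prob_centered_itv// -(law l)//; exact: measurable_itv.
under eq_bigr do rewrite factor.
by rewrite prodEFin prodr_const cardsT card_ord.
Qed.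

End small_noise.

(** * The detection bound *)

Theorem theoremV5 (R : realType) (N : nat) (P d0 beta A : R)
    (x : 'I_N -> R * R) (C : set (R * R)) (W : 'I_N -> set (R * R))
    (areaW : 'I_N -> R) (s : R * R) (i : 'I_N) (U L : 'I_N -> R)
    (d : measure_display) (T : measurableType d) (Pr : probability T R)
    (n : R -> 'I_N -> {RV Pr >-> R})
    (hN : (3 <= N)%N) (hP : 0 < P) (hd0 : 0 < d0) (hbeta : 2 < beta)
    (hA : 0 < A)
    (hx : ~ collinear x)
    (hC : compact C) (hCA : area C = A%:E)
    (hW : forall j : 'I_N, compact (W j))
    (hWA : forall j : 'I_N, area (W j) = (areaW j)%:E)
    (hWC : \bigcup_j W j = C)
    (hWW : forall j k : 'I_N, j != k -> area (W j `&` W k) = 0%E)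
    (hsi : W i s) (hsj : forall j : 'I_N, j != i -> ~ W j s)
    (hU0 : forall j : 'I_N, j != i -> 0 < U j)
    (hL0 : forall j : 'I_N, j != i -> 0 < L j)
    (hU : forall j : 'I_N, j != i -> forall (y : R * R) (l : 'I_N), W j y ->
      `|log_ratio d0 beta s y (x l)| <= U j)
    (hL : forall j : 'I_N, j != i -> forall y : R * R, W j y ->
      L j <= \sum_(l < N) log_ratio d0 beta s y (x l) ^+ 2)
    (hn : forall sigma : R, 0 < sigma -> iid_normal sigma (n sigma)) :
  let m := fun (sigma : R) (w : T) =>
    measurement P d0 beta x s (n sigma) w in
  let p := fun (sigma : R) (w : T) =>
    total_density P d0 beta A sigma x W (m sigma w) in
  let psi := fun (sigma : R) (w : T) =>
    Psi P d0 beta A sigma x W areaW L i (m sigma w) in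
  [/\ forall sigma : R, 0 < sigma ->
        ((Omega U L i sigma)%:E <=
         Pr [set w | (psi sigma w <=
             joint_density P d0 beta A sigma x (m sigma w) (W i))%R])%E,
      forall (sigma : R) (w : T), 0 < sigma -> 0 < p sigma w,
      forall w : T, p sigma w - psi sigma w @[sigma --> 0^'+] --> 0
    & Omega U L i sigma @[sigma --> 0^'+] --> 1^'- ].
Proof.
move=> m p psi.
have N0 : (0 < N)%N := ltnW (ltnW hN).
have mW j : measurable (W j) by exact: compact_measurable_prod.
have eta0 j : j != i -> 0 < eta_const U L j.
  by move=> ji; apply: eta_const_gt0; [exact: hU0|exact: hL0|].
have mm sigma l : measurable_fun setT (fun w => m sigma w l).
  by apply: measurable_funD.
split; last exact: cvg_Omega.
- move=> sigma s0.
  (* The smallest threshold controls all the regions at once. *)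
  have [j0 j0i] := ord_neq_exists i hN.
  pose j := [arg min_(j < j0 | j != i) eta_const U L j]%O.
  have [ji etaj] : j != i /\
      forall k, k != i -> eta_const U L j <= eta_const U L k.
    by rewrite /j; case: arg_minP.
  set e := eta_const U L j in etaj.
  have mpsi : measurable_fun setT (psi sigma).
    apply: measurable_funB => //; apply: measurable_sum => k.
    exact: measurable_joint_density.
  pose small := [set w | forall l, - e < n sigma l w < e].
  apply: (@le_trans _ _ (Pr small)).
    rewrite (small_noise_prob _ _ _ s0 (eta0 j ji) (hn sigma s0)) lee_fin.
    exact: Omega_le_factor.
  apply: le_measure; rewrite ?inE//; first exact: measurable_small_noise.
    rewrite -[X in measurable X]setTI; apply: measurable_fun_le => //.
    exact: measurable_joint_density.
  (* The comparison with [Psi] cancels the joint density of [W i] and leaves one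
     inequality per wrong region. *)
  move=> w smallw; rewrite /= /psi /Psi /total_density (bigD1 i)//= -addrA.
  rewrite gerDl subr_le0; apply: ler_sum => k ki.
  apply: (joint_density_le _ _ _ _ _ _ hP hd0
    _ _ _ _ hA s0 (mW k) (hWA k)) => y Wy.
  have -> : sqresidual P d0 beta x (m sigma w) y =
      \sum_l (log_ratio d0 beta s y (x l) + n sigma l w) ^+ 2.
    apply: eq_bigr => l _; congr (_ ^+ 2).
    by rewrite /m /measurement addrAC log_powerB.
  apply: (sum_sqr_perturbed (U k) (L k) (eta_const U L k)) => //.
  + by move=> l; exact: hU.
  + move=> l; apply: le_trans (etaj k ki).
    by rewrite ler_norml; have /andP[] := smallw l; move=> /ltW -> /ltW ->.
  + by rewrite -(eta_constE U L k (hL0 k ki)) lerDr sqr_ge0.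
  + exact: hL.
- move=> sigma w s0.
  have [k Wk0] : exists k, areaW k != 0.
    (* Otherwise their union would be a null set, against [0 < A]. *)
    apply: contrapT => /forallNP Wk0.
    have : area C = 0%E.
      rewrite -hWC; apply: measure_bigcup_eq0 => // k.
      by move: (hWA k); have /negP/negPn/eqP -> := Wk0 k.
    by rewrite hCA => -[] A0; move: hA; rewrite A0 ltxx.
  rewrite /p /total_density (bigD1 k)//= ltr_pwDl//.
    exact: (joint_density_gt0 _ _ _ _ _ _ hP hd0
      _ _ _ hA s0 (mW k) (hWA k) Wk0).
  by apply: sumr_ge0 => l _; exact: joint_density_ge0.
- move=> w.
  pose gap sigma j := areaW j * expR (- L j / (4 * sigma ^+ 2)) /
    (A * (2 * pi * sigma ^+ 2) `^ (N%:R / 2)).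
  have -> : (fun sigma => p sigma w - psi sigma w) =
      (fun sigma => \sum_(j < N | j != i) gap sigma j).
    by apply/funext => sigma; rewrite /psi /Psi subKr.
  have sum0 : \sum_(j < N | j != i) (0 : R) = 0 by rewrite big1.
  suff : \sum_(j < N | j != i) gap sigma j @[sigma --> 0^'+] -->
      \sum_(j < N | j != i) (0 : R) by rewrite sum0.
  apply: cvg_big => [|j ji]; first exact: add_continuous.
  apply: cvg_gap_term; exact: hL0.
Qed.
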